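(* Let $\mathcal{D}$ be a $2$-$(v,b,r,k,1)$ design with $v>k^2-k+1$, let $\mathcal{A}$ be a maximal $(n,d)$-arc in $\mathcal{D}$, and let $\mathcal{A}'$ be the corresponding dual $(n',d')$-arc (so $n',d'>1$). Then $n'=1+k(d'-1)$ holds if and only if the points of $\mathcal{A}'$ (as points) and the secants of $\mathcal{A}'$ (as blocks) constitute a $2$-$(n',d',1)$ design, which is a non-canonical maximal clique in the block graph of $\mathcal{D}$ (that is, the set $\mathcal{A}'$ of blocks of $\mathcal{D}$ is a non-canonical maximal clique).
   Context: A $2$-$(v,b,r,k,1)$ design is a $2$-$(v,k,1)$ design, i.e. a collection of $k$-subsets (blocks) of a $v$-set of points such that every pair of distinct points is contained in exactly one block, where $b=\frac{v(v-1)}{k(k-1)}$ is the number of blocks and $r=\frac{v-1}{k-1}$ is the number of blocks through each point. An $(n,d)$-arc ($n,d>1$) in $\mathcal{D}$ is a set $\mathcal{A}$ of $n$ points such that each block meets $\mathcal{A}$ in at most $d$ points and at least one block meets it in exactly $d$ points. Always $n\le 1+r(d-1)$, with equality if and only if each block meets $\mathcal{A}$ in $0$ or $d$ points; in case of equality $\mathcal{A}$ is called maximal. Blocks disjoint from $\mathcal{A}$ are called exterior, and blocks meeting $\mathcal{A}$ in $d$ points are called secants. The dual $\mathcal{D}'$ of $\mathcal{D}$ is the incidence structure obtained by exchanging the roles of points and blocks. For a maximal $(n,d)$-arc $\mathcal{A}$ in $\mathcal{D}$, the corresponding dual arc $\mathcal{A}'$ is the set of blocks of $\mathcal{D}$ exterior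 to $\mathcal{A}$. It is a maximal $(n',d')$-arc in $\mathcal{D}'$, meaning that it consists of $n'$ points of $\mathcal{D}'$ (blocks of $\mathcal{D}$) and every block of $\mathcal{D}'$ (point of $\mathcal{D}$) is incident with either $0$ or $d'$ elements of $\mathcal{A}'$; here $d'=(r-1)/d$ and $n'=b-nr/d$. The secants of $\mathcal{A}'$ are the points of $\mathcal{D}$ incident with exactly $d'$ elements of $\mathcal{A}'$, each identified as a block with the set of those $d'$ elements of $\mathcal{A}'$. The block graph of $\mathcal{D}$ has the blocks of $\mathcal{D}$ as vertices, two blocks being adjacent if they have exactly one point in common. A clique is canonical if it consists of all blocks of $\mathcal{D}$ through some fixed point, and non-canonical otherwise. *)

(* Defs.v *)
From mathcomp Require Import all_boot.

Set Implicit Arguments.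
Unset Strict Implicit.
Unset Printing Implicit Defensive.

(* Blocks are sets of points, and the point set is a subset of an ambient
   finite type: in the dual of a structure on T the points are some, not all,
   of the elements of {set T}. *)
Record incidence_structure (T : finType) := IncidenceStructure {
  points : {set T};
  blocks : {set {set T}}
}.

Section Incidence.
Variable T : finType.
Implicit Types (D : incidence_structure T) (A : {set T}) (C : {set {set T}}).

Definition pencil D (x : T) : {set {set T}} := [set B in blocks D | x \in B].

(* The point x of D, seen as a block of the dual, is represented by its pencil.
   This identifies no two points as soon as distinct points have distinct
   pencils, e.g. in a 2-(v,k,1) design with r > 1. *)
Definition dual D : incidence_structure {set T} :=
  IncidenceStructure (blocks D) [set pencil D x | x in points D].

(* 2-(v,k,1) design; 1 < k is implicit in r = (v-1)/(k-1). *)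
Definition is_2design D (v k : nat) : Prop :=
  [/\ 1 < k,
      #|points D| = v,
      forall B, B \in blocks D -> B \subset points D /\ #|B| = k
    & forall x y, x \in points D -> y \in points D -> x != y ->
         #|[set B in blocks D | (x \in B) && (y \in B)]| = 1].

(* 2-(v,b,r,k,1) design; double counting gives r = (v-1)/(k-1) and
   b = v(v-1)/(k(k-1)) when v > 0. *)
Definition is_2design_params D (v b r k : nat) : Prop :=
  [/\ is_2design D v k,
      #|blocks D| = b
    & forall x, x \in points D -> #|pencil D x| = r].

Definition is_arc D (n d : nat) A : Prop :=
  [/\ 1 < n /\ 1 < d,
      A \subset points D /\ #|A| = n,
      forall B, B \in blocks D -> #|B :&: A| <= d
    & exists2 B, B \in blocks D & #|B :&: A| = d].

(* r is the number of blocks through each point of the ambient design. *)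
Definition is_maximal_arc D (r n d : nat) A : Prop :=
  is_arc D n d A /\ n = 1 + r * (d - 1).

Definition exterior D A : {set {set T}} :=
  [set B in blocks D | [disjoint B & A]].

Definition secants D (d : nat) A : {set {set T}} :=
  [set B in blocks D | #|B :&: A| == d].

(* A secant, as a block on the points of A, is the set of its points in A. *)
Definition arc_structure D (d : nat) A : incidence_structure T :=
  IncidenceStructure A [set B :&: A | B in secants D d A].

(* Adjacency in the block graph; cliques below are sets of pairwise adjacent
   vertices of that graph. *)
Definition block_adj (B1 B2 : {set T}) : bool := #|B1 :&: B2| == 1.

Definition is_clique D C : bool :=
  (C \subset blocks D) &&
  [forall B1 in C, forall B2 in C, (B1 != B2) ==> block_adj B1 B2].

Definition canonical_clique D C : Prop :=
  exists2 x, x \in points D & C = pencil D x.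

End Incidence.

(* Main.v *)
Require Import Defs.
From mathcomp Require Import all_boot.
From mathcomp Require Import zify.

(** Everything rests on one double count: for a family F of sets and a set S,
    the sum of |B :&: S| over B in F is the sum over x in S of the number of
    members of F through x ([sum_card_setI]).

    Counting along the pencil of a point of A, resp. of a point p off A, shows
    that every block meets A in 0 or d points, and that p lies on exactly
    d' = (r - 1) / d exterior blocks; points of A lie on none.  Hence the
    exterior blocks meet a given block X in |X :\: A| * d' points altogether
    ([sum_exterior_setI]).

    For X exterior, this total is k * d'.  The block X itself contributes k,
    and each of the n' - 1 other exterior blocks contributes at most 1.  So
    n' - 1 = k * (d' - 1) holds exactly when any two exterior blocks meet
    ([exterior_cliqueP]).  This already gives one direction of the equivalence.

    Conversely, let the exterior blocks form a clique.  Two of them share one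
    point, which is off A and so on exactly d' of them: this is the 2-design.
    If another block X, which meets A in d points, could be added to the clique,
    the total for X would be n' = (k - d) * d'; together with
    n' = 1 + k * (d' - 1) this forces k = 1 + d * d' = r, whereas v > k^2 - k + 1
    means r > k.  Finally the clique is not a pencil, because a point is on at
    most d' < r exterior blocks. *)

Set Implicit Arguments.
Unset Strict Implicit.
Unset Printing Implicit Defensive.

(** * Double counting in a 2-design *)

Lemma sum_card_setI (T : finType) (F : {set {set T}}) (S : {set T}) :
  \sum_(B in F) #|B :&: S| = \sum_(x in S) #|[set B in F | x \in B]|.
Proof.
transitivity (\sum_(B in F) \sum_(x in S) (x \in B : nat)).
  apply: eq_bigr => B _; rewrite -sum1_card big_mkcond [RHS]big_mkcond /=.
  by apply: eq_bigr => x _; rewrite inE; case: (x \in B); case: (x \in S).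
rewrite exchange_big /=; apply: eq_bigr => x _.
rewrite -sum1_card big_mkcond [RHS]big_mkcond /=.
by apply: eq_bigr => B _; rewrite inE; case: (B \in F); case: (x \in B).
Qed.

(** The blocks through x partition the points other than x, and all of them
    contain x.  With S the whole point set this relates v to r; with S an arc it
    gives the properties of maximal arcs. *)
Lemma sum_pencil_setI (T : finType) (D : incidence_structure T) v k x
    (S : {set T}) :
  is_2design D v k -> x \in points D -> S \subset points D ->
  \sum_(B in pencil D x) #|B :&: S| = (x \in S) * #|pencil D x| + #|S :\ x|.
Proof.
move=> [_ _ _ hpair] Dx /subsetP sSD; rewrite sum_card_setI.
have one y : y \in S -> y != x -> #|[set B in pencil D x | y \in B]| = 1.
  move=> Sy yx; rewrite -(hpair x y Dx (sSD y Sy)) 1?eq_sym //.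
  by apply: eq_card => B; rewrite !inE andbA.
have <- : \sum_(y in S :\ x) #|[set B in pencil D x | y \in B]| = #|S :\ x|.
  rewrite -sum1_card; apply: eq_bigr => y.
  by rewrite !inE => /andP[yx Sy]; rewrite one.
have [Sx|nSx] := boolP (x \in S); last first.
  by apply: eq_bigl => y; rewrite !inE; case: eqVneq => // ->; rewrite (negPf nSx).
rewrite (bigD1 x) //= mul1n; congr (_ + _).
  by apply: eq_card => B; rewrite !inE -andbA andbb.
by apply: eq_bigl => y; rewrite !inE andbC.
Qed.

Lemma block_eq (T : finType) (D : incidence_structure T) v k x y B1 B2 :
  is_2design D v k -> B1 \in blocks D -> B2 \in blocks D -> x != y ->
  x \in B1 -> y \in B1 -> x \in B2 -> y \in B2 -> B1 = B2.
Proof.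
move=> [_ _ hB hpair] DB1 DB2 xy xB1 yB1 xB2 yB2.
have /subsetP sB1 := (hB _ DB1).1.
have /eqP/cards1P[B eqB] := hpair x y (sB1 _ xB1) (sB1 _ yB1) xy.
have : B1 \in [set B] by rewrite -eqB !inE DB1 xB1 yB1.
have : B2 \in [set B] by rewrite -eqB !inE DB2 xB2 yB2.
by rewrite !inE => /eqP-> /eqP->.
Qed.

Lemma card_blockI_le1 (T : finType) (D : incidence_structure T) v k B1 B2 :
  is_2design D v k -> B1 \in blocks D -> B2 \in blocks D -> B1 != B2 ->
  #|B1 :&: B2| <= 1.
Proof.
move=> hD DB1 DB2 neB; apply/card_le1_eqP => x y.
rewrite !inE => /andP[xB1 xB2] /andP[yB1 yB2].
by apply: contraNeq neB => xy; apply/eqP; apply: (block_eq hD DB1 DB2 xy).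
Qed.

Lemma card_points (T : finType) (D : incidence_structure T) v b r k x :
  is_2design_params D v b r k -> x \in points D -> v = 1 + r * (k - 1).
Proof.
move=> [hD _ hr] Dx; have [k_gt1 hv hB _] := hD.
have := sum_pencil_setI hD Dx (subxx _); rewrite Dx mul1n hr //.
rewrite (eq_bigr (fun=> k)); last first.
  move=> B; rewrite inE => /andP[DB _].
  by have [/setIidPl-> ->] := hB _ DB.
rewrite sum_nat_const hr // => rk.
move: hv; rewrite (cardsD1 x) Dx => <-; nia.
Qed.

(** * Maximal arcs and their exterior blocks *)

(** Through a point of A, the r blocks together cover the n - 1 = r * (d - 1)
    other points of A, at most d - 1 each; so each of them reaches the bound. *)
Lemma card_blockI_arc (T : finType) (D : incidence_structure T) v b r k n d
    (A B : {set T}) :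
  is_2design_params D v b r k -> is_maximal_arc D r n d A ->
  B \in blocks D -> ~~ [disjoint B & A] -> #|B :&: A| = d.
Proof.
move=> [hD _ hr] [[[_ d_gt1] [sAD cA] hle _] def_n] DB /pred0Pn[x /andP[/= xB xA]].
have Dx := subsetP sAD x xA.
have := sum_pencil_setI hD Dx sAD; rewrite xA mul1n hr // => sumA.
have cA1 := cardsD1 x A; rewrite xA cA in cA1.
have Px : B \in pencil D x by rewrite inE DB.
have leA C : C \in pencil D x -> #|C :&: A| <= d ?= iff (#|C :&: A| == d).
  by rewrite inE => /andP[DC _]; split=> //; apply: hle.
have [_ eqA] := leqif_sum leA.
have := eqA; rewrite sum_nat_const hr // sumA.
have -> : r + #|A :\ x| = r * d by nia.
by rewrite eqxx => /esym/forall_inP/(_ B Px)/eqP.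
Qed.

Lemma sum_card_blockI_arc (T : finType) (D : incidence_structure T) v b r k n d
    (A : {set T}) (F : {set {set T}}) :
  is_2design_params D v b r k -> is_maximal_arc D r n d A ->
  F \subset blocks D ->
  \sum_(B in F) #|B :&: A| = #|F :\: exterior D A| * d.
Proof.
move=> hD hA /subsetP sFD; rewrite (big_setID (exterior D A)) /= big1 => [|B].
  rewrite add0n -sum_nat_const; apply: eq_bigr => B; rewrite !inE.
  move=> /andP[nE FB]; rewrite (sFD _ FB) /= in nE.
  exact: (card_blockI_arc hD hA (sFD _ FB)).
rewrite !inE => /andP[_ /andP[_ dBA]].
by apply/eqP; rewrite cards_eq0 setI_eq0.
Qed.

Lemma card_exterior (T : finType) (D : incidence_structure T) v b r k n d
    (A : {set T}) :
  is_2design_params D v b r k -> is_maximal_arc D r n d A ->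
  #|exterior D A| = b - (n * r) %/ d.
Proof.
move=> hD hA; have := sum_card_blockI_arc hD hA (subxx _).
have [_ cb hr] := hD; have [[[_ d_gt1] [sAD cA] _ _] _] := hA.
rewrite sum_card_setI (eq_bigr (fun=> r)); last first.
  by move=> x xA; rewrite -(hr x) ?(subsetP sAD) //.
have sE : exterior D A \subset blocks D.
  by apply/subsetP => B; rewrite inE => /andP[].
rewrite sum_nat_const cA => ->; rewrite mulnK; last by lia.
by rewrite cardsD (setIidPr sE) cb subKn // -cb subset_leq_card.
Qed.

(** The r - e non-exterior blocks through p partition A into sets of size d, so
    (r - e) * d = n = 1 + r * (d - 1).  The quotient (r - 1) / d is thus exact,
    as the proof of maximality requires. *)
Lemma card_exterior_pencil (T : finType) (D : incidence_structure T) v b r k n d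
    (A : {set T}) p :
  is_2design_params D v b r k -> is_maximal_arc D r n d A ->
  p \in points D -> p \notin A ->
  r = 1 + d * #|pencil D p :&: exterior D A|.
Proof.
move=> hD hA Dp nAp.
have sP : pencil D p \subset blocks D.
  by apply/subsetP => B; rewrite inE => /andP[].
have := sum_card_blockI_arc hD hA sP.
have [h2 _ hr] := hD; have [[[_ d_gt1] [sAD cA] _ _] def_n] := hA.
rewrite (sum_pencil_setI h2 Dp sAD) (negPf nAp) mul0n add0n.
have := cardsID (exterior D A) (pencil D p); rewrite hr //.
have := cardsD1 p A; rewrite (negPf nAp) cA add0n => <-; rewrite {}def_n.
nia.
Qed.

Lemma card_exterior_pencil_div (T : finType) (D : incidence_structure T)
    v b r k n d (A : {set T}) p :
  is_2design_params D v b r k -> is_maximal_arc D r n d A ->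
  p \in points D -> p \notin A ->
  #|pencil D p :&: exterior D A| = (r - 1) %/ d.
Proof.
move=> hD hA Dp nAp; have [[[_ d_gt1] _ _ _] _] := hA.
by rewrite (card_exterior_pencil hD hA Dp nAp) addKn mulKn //; lia.
Qed.

Lemma sum_exterior_setI (T : finType) (D : incidence_structure T)
    v b r k n d (A X : {set T}) :
  is_2design_params D v b r k -> is_maximal_arc D r n d A -> X \in blocks D ->
  \sum_(B in exterior D A) #|B :&: X| = #|X :\: A| * ((r - 1) %/ d).
Proof.
move=> hD hA DX; have [[_ _ hB _] _ _] := hD.
have /subsetP sX := (hB _ DX).1.
rewrite sum_card_setI (big_setID A) /= big1 => [|x].
  rewrite add0n -sum_nat_const; apply: eq_bigr => x; rewrite !inE.
  move=> /andP[nAx Xx]; rewrite -(card_exterior_pencil_div hD hA (sX _ Xx) nAx).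
  by apply: eq_card => B; rewrite !inE; case: (B \in blocks D) => //=; rewrite andbC.
rewrite !inE => /andP[_ Ax]; apply/eqP; rewrite cards_eq0; apply/eqP/setP=> B.
rewrite !inE; apply/negP => /andP[/andP[_ dBA] Bx].
by have := disjointFr dBA Bx; rewrite Ax.
Qed.

(** * Cliques in the block graph *)

(** Exterior blocks have k points off A, so their intersections with a fixed
    exterior block B add up to k * d'; B accounts for k of it, and every other
    exterior block for 0 or 1. *)
Lemma exterior_cliqueP (T : finType) (D : incidence_structure T)
    v b r k n d d' (A : {set T}) :
  is_2design_params D v b r k -> is_maximal_arc D r n d A ->
  d' = (r - 1) %/ d -> 0 < d' -> 0 < #|exterior D A| ->
  #|exterior D A| = 1 + k * (d' - 1) <-> is_clique D (exterior D A).
Proof.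
move=> hD hA def_d' d'_gt0 E_gt0; have [h2 _ _] := hD; have [_ _ hB _] := h2.
have sE : exterior D A \subset blocks D.
  by apply/subsetP => B; rewrite inE => /andP[].
have total B : B \in exterior D A ->
    k + \sum_(C in exterior D A :\ B) #|C :&: B| = k * d'.
  move=> EB; have [DB dBA] : B \in blocks D /\ [disjoint B & A].
    by move: EB; rewrite inE => /andP[].
  have cB := (hB _ DB).2.
  have := sum_exterior_setI hD hA DB; rewrite -def_d' (big_setD1 B) //= setIid cB.
  by have /setDidPl-> := dBA; rewrite cB.
have le1 B C : B \in exterior D A -> C \in exterior D A :\ B ->
    #|C :&: B| <= 1 ?= iff block_adj C B.
  move=> EB /setD1P[neCB EC]; split=> //.
  by apply: card_blockI_le1 h2 _ _ neCB; apply: (subsetP sE).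
split=> [cE | /andP[_ /forall_inP cl]].
  rewrite /is_clique sE; apply/forall_inP => C EC; apply/forall_inP => B EB.
  apply/implyP => neCB; have [_] := leqif_sum (fun C => le1 B C EB).
  rewrite sum1_card => eq1.
  have : \sum_(C in exterior D A :\ B) #|C :&: B| == #|exterior D A :\ B|.
    (* k + sum = k * d' while n' - 1 = k * (d' - 1): each term must be 1. *)
    have := total _ EB; have := cardsD1 B (exterior D A); rewrite EB cE.
    by move=> ? ?; apply/eqP; nia.
  by rewrite eq1 => /forall_inP/(_ C); apply; apply/setD1P.
have [B EB] := card_gt0P E_gt0.
have := total _ EB; rewrite (eq_bigr (fun=> 1)) => [|C /setD1P[neCB EC]].
  by rewrite sum1_card (cardsD1 B (exterior D A)) EB; nia.
by have /forall_inP/(_ B EB)/implyP/(_ neCB)/eqP := cl C EC.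
Qed.

(** The common point of two exterior blocks is off A, so its d' exterior blocks
    form a secant of the dual arc.  Any other secant through the two blocks comes
    from a point on both of them, hence from the same point. *)
Lemma clique_exterior_design (T : finType) (D : incidence_structure T)
    v b r k n d d' (A : {set T}) :
  is_2design_params D v b r k -> is_maximal_arc D r n d A ->
  d' = (r - 1) %/ d -> 1 < d' -> is_clique D (exterior D A) ->
  is_2design (arc_structure (dual D) d' (exterior D A)) #|exterior D A| d'.
Proof.
move=> hD hA def_d' d'_gt1 /andP[_ /forall_inP cl].
have [h2 _ _] := hD; have [_ _ hB _] := h2.
split=> //= [Q /imsetP[P] | B1 B2 EB1 EB2 neB].
  by rewrite inE => /andP[_ /eqP cP] ->; rewrite subsetIr.
have /forall_inP/(_ B2 EB2)/implyP/(_ neB)/cards1P[x eqx] := cl B1 EB1.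
have on_x y : (y \in B1) && (y \in B2) = (y == x) by rewrite -in_setI eqx inE.
have /andP[xB1 xB2] : (x \in B1) && (x \in B2) by rewrite on_x.
have /andP[DB1 dB1] : (B1 \in blocks D) && [disjoint B1 & A].
  by move: EB1; rewrite inE.
have /andP[DB2 dB2] : (B2 \in blocks D) && [disjoint B2 & A].
  by move: EB2; rewrite inE.
have Dx : x \in points D by apply: (subsetP (hB _ DB1).1).
have nAx : x \notin A by rewrite (disjointFr dB1).
apply/eqP/cards1P; exists (pencil D x :&: exterior D A).
apply/setP => Q; rewrite !inE; apply/andP/eqP => [[/imsetP[P]] | ->].
  rewrite inE => /andP[/imsetP[y Dy ->] _] -> /andP[].
  rewrite !inE => /andP[/andP[_ yB1] _] /andP[/andP[_ yB2] _].
  by have := on_x y; rewrite yB1 yB2 => /esym/eqP->.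
split; last by rewrite !inE DB1 DB2 dB1 dB2 xB1 xB2.
apply/imsetP; exists (pencil D x) => //; rewrite inE imset_f //=.
by rewrite (card_exterior_pencil_div hD hA) // def_d'.
Qed.

(** A block X adjacent to all the exterior blocks would meet them in
    (k - d) * d' = 1 + k * (d' - 1) points altogether, that is
    k = 1 + d * d' = r, contrary to k < r. *)
Lemma maxset_exterior (T : finType) (D : incidence_structure T)
    v b r k n d d' (A : {set T}) :
  is_2design_params D v b r k -> k < r -> is_maximal_arc D r n d A ->
  r = 1 + d * d' -> 0 < d' -> is_clique D (exterior D A) ->
  #|exterior D A| = 1 + k * (d' - 1) -> maxset (is_clique D) (exterior D A).
Proof.
move=> hD lt_kr hA def_r d'_gt0 clE cE; have [[_ _ hB _] _ _] := hD.
have [[[_ d_gt1] _ _ _] _] := hA.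
apply/maxsetP; split=> // C /andP[/subsetP sC /forall_inP clC] sEC.
apply/eqP; rewrite eqEsubset sEC andbT; apply/subsetP => X CX.
rewrite -[_ \in _]negbK; apply/negP => nEX; have DX := sC _ CX.
have nd : ~~ [disjoint X & A] by apply: contra nEX; rewrite inE DX.
have := sum_exterior_setI hD hA DX.
have -> : (r - 1) %/ d = d' by rewrite def_r addKn mulKn //; lia.
rewrite cardsD (card_blockI_arc hD hA DX nd) (hB _ DX).2.
rewrite (eq_bigr (fun=> 1)) => [|B EB]; last first.
  have /forall_inP/(_ X CX)/implyP adj := clC _ (subsetP sEC _ EB).
  by apply/eqP/adj; apply: contraNneq nEX => <-.
by rewrite sum1_card cE; nia.
Qed.

Theorem proposition6 (T : finType) (D : incidence_structure T)
    (v b r k n d n' d' : nat) (A : {set T})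
    (hD : is_2design_params D v b r k)
    (hv : k ^ 2 - k + 1 < v)
    (hA : is_maximal_arc D r n d A)
    (def_d' : d' = (r - 1) %/ d)
    (def_n' : n' = b - (n * r) %/ d)
    (n'_gt1 : 1 < n') (d'_gt1 : 1 < d') :
  n' = 1 + k * (d' - 1) <->
  [/\ is_2design (arc_structure (dual D) d' (exterior D A)) n' d',
      maxset (is_clique D) (exterior D A)
    & ~ canonical_clique D (exterior D A)].
Proof.
have cE : #|exterior D A| = n' by rewrite (card_exterior hD hA).
have E_gt0 : 0 < #|exterior D A| by lia.
have d'_gt0 : 0 < d' by lia.
have cliqueE := exterior_cliqueP hD hA def_d' d'_gt0 E_gt0.
rewrite cE in cliqueE; split=> [eq_n' | [_ /maxsetp clE _]]; last exact/cliqueE.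
have clE : is_clique D (exterior D A) by apply/cliqueE.
have [[k_gt1 _ hB _] _ hr] := hD; have [[[_ d_gt1] _ _ _] _] := hA.
have [B EB] := card_gt0P E_gt0.
have /andP[DB dBA] : (B \in blocks D) && [disjoint B & A] by move: EB; rewrite inE.
have [sBD cB] := hB _ DB.
have [p Bp] : exists p, p \in B by apply/card_gt0P; rewrite cB; lia.
have Dp := subsetP sBD _ Bp.
have lt_kr : k < r by have := card_points hD Dp; move: hv; rewrite -mulnn; nia.
have nAp : p \notin A by rewrite (disjointFr dBA).
have def_r : r = 1 + d * d'.
  have := card_exterior_pencil hD hA Dp nAp.
  by rewrite (card_exterior_pencil_div hD hA Dp nAp) -def_d'.
split; first by rewrite -cE; apply: clique_exterior_design hD hA _ _ _.
  by apply: maxset_exterior hD lt_kr hA def_r _ _ _ => //; rewrite cE.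
case=> x Dx eqE.
have nAx : x \notin A.
  by move: EB dBA; rewrite eqE inE => /andP[_ xB] /disjointFr->.
have := card_exterior_pencil_div hD hA Dx nAx.
by rewrite eqE setIid hr // -def_d' => ?; nia.
Qed.
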